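(* Let $\varphi(P_1,\ldots,P_\ell)$ be an MSO sentence over a finite alphabet $A$ using monadic predicate symbols $P_1,\ldots,P_\ell$, and let $\mathbf{P}_1,\ldots,\mathbf{P}_\ell$ be monadic predicates such that the language $L_{\varphi,\mathbf{P}_1,\ldots,\mathbf{P}_\ell}$ is regular. Then there exist regular monadic predicates $\mathbf{Q}_1,\ldots,\mathbf{Q}_\ell$ such that $L_{\varphi,\mathbf{Q}_1,\ldots,\mathbf{Q}_\ell} = L_{\varphi,\mathbf{P}_1,\ldots,\mathbf{P}_\ell}$.
   Context: A monadic predicate is a family $\mathbf{P} = (\mathbf{P}_n)_{n\in\mathbb{N}}$ with $\mathbf{P}_n \subseteq \{0,\ldots,n-1\}$ (arbitrary, non-uniform). MSO formulae over words $u = u_0\cdots u_{n-1}$ are built from $\mathbf{a}(x)$ ($a\in A$), $x\le y$, $P(x)$, Boolean connectives and first-order and monadic second-order quantification over positions; on a word of length $n$, $P(x)$ holds iff $x \in \mathbf{P}_n$ where $\mathbf{P}$ interprets $P$. For a sentence $\varphi$ and predicates $\mathbf{P}_1,\ldots,\mathbf{P}_\ell$, $L_{\varphi,\mathbf{P}_1,\ldots,\mathbf{P}_\ell} = \{u\in A^* \mid u,\mathbf{P}_1,\ldots,\mathbf{P}_\ell\models\varphi\}$. A monadic predicate $\mathbf{Q}$ is regular if there is an MSO formula $\psi(x)$ (without predicate symbols) over the one-letter alphabet $\{a\}$ such that $\mathbf{Q}_n = \{x \in\{0,\ldots,n-1\}\mid a^n,x\models\psi\}$ for all $n$; equivalently,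 $\mathbf{Q}$ is a Boolean combination of the predicates $\{c\}$, $(\{n-1-c\})_{n}$, $\{x \mid x\equiv r \bmod q\}$, and $(\{x \mid n-1 \equiv r \bmod q\})_n$ for constants $c,q,r\in\mathbb{N}$; equivalently, the language $\{w_n \mid n\in\mathbb{N}\}\subseteq\{0,1\}^*$, where $w_n$ is the characteristic word of $\mathbf{Q}_n$ of length $n$, is regular. *)

(* Defs.v *)
From mathcomp Require Import all_boot.

Set Implicit Arguments.
Unset Strict Implicit.
Unset Printing Implicit Defensive.

(* MSO formulae with letters in A and monadic predicate symbols in S.
   Formulae are well scoped: [mso A S m k] has its free variables among m
   first-order and k second-order de Bruijn variables, index 0 being the
   innermost one.  In particular [mso A S 0 0] is the type of sentences. *)
Inductive mso (A S : Type) : nat -> nat -> Type :=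
| Letter m k (a : A) (x : 'I_m) : mso A S m k
| Le m k (x y : 'I_m) : mso A S m k
| Pred m k (p : S) (x : 'I_m) : mso A S m k
| Mem m k (x : 'I_m) (X : 'I_k) : mso A S m k
| Not m k (f : mso A S m k) : mso A S m k
| And m k (f g : mso A S m k) : mso A S m k
| Or m k (f g : mso A S m k) : mso A S m k
| Ex1 m k (f : mso A S m.+1 k) : mso A S m k
| All1 m k (f : mso A S m.+1 k) : mso A S m k
| Ex2 m k (f : mso A S m k.+1) : mso A S m k
| All2 m k (f : mso A S m k.+1) : mso A S m k.

Definition push (T : Type) (m : nat) (t : T) (v : 'I_m -> T) : 'I_m.+1 -> T :=
  fun i => if unlift ord0 i is Some j then v j else t.

(* Since the positions of a word form the finite type 'I_n, satisfaction is
   decidable; second-order variables range over all sets of positions. *)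
Fixpoint sat (A : eqType) (S : Type) (n : nat) (u : n.-tuple A)
    (P : S -> {set 'I_n}) (m k : nat) (f : mso A S m k) :
    ('I_m -> 'I_n) -> ('I_k -> {set 'I_n}) -> bool :=
  match f in mso _ _ m k
    return ('I_m -> 'I_n) -> ('I_k -> {set 'I_n}) -> bool with
  | Letter _ _ a x => fun v V => tnth u (v x) == a
  | Le _ _ x y => fun v V => v x <= v y
  | Pred _ _ p x => fun v V => v x \in P p
  | Mem _ _ x X => fun v V => v x \in V X
  | Not _ _ f => fun v V => ~~ sat u P f v V
  | And _ _ f g => fun v V => sat u P f v V && sat u P g v V
  | Or _ _ f g => fun v V => sat u P f v V || sat u P g v V
  | Ex1 _ _ f => fun v V => [exists x : 'I_n, sat u P f (push x v) V]
  | All1 _ _ f => fun v V => [forall x : 'I_n, sat u P f (push x v) V]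
  | Ex2 _ _ f => fun v V => [exists X : {set 'I_n}, sat u P f v (push X V)]
  | All2 _ _ f => fun v V => [forall X : {set 'I_n}, sat u P f v (push X V)]
  end.

Definition no_var (T : Type) (i : 'I_0) : T := match notF (valP i) with end.

Definition monadic_predicate := forall n : nat, {set 'I_n}.

Definition language (A : eqType) (S : Type) (f : mso A S 0 0)
    (P : S -> monadic_predicate) : pred (seq A) :=
  fun u => sat (in_tuple u) (fun p => P p (size u)) f (@no_var _) (@no_var _).

Definition regular_predicate (Q : monadic_predicate) : Prop :=
  exists psi : mso unit void 1 0, forall n : nat,
    Q n = [set x : 'I_n |
            sat (nseq_tuple n tt) (of_void _) psi (fun=> x) (@no_var _)].

Record dfa (A : Type) := Dfa {
  dfa_state : finType;
  dfa_init : dfa_state;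
  dfa_final : {set dfa_state};
  dfa_step : dfa_state -> A -> dfa_state
}.

Definition dfa_lang (A : Type) (M : dfa A) : pred (seq A) :=
  fun u => foldl (@dfa_step A M) (dfa_init M) u \in dfa_final M.

Definition regular_language (A : finType) (L : pred (seq A)) : Prop :=
  exists M : dfa A, L =i dfa_lang M.

(* Main.v *)
Require Import Defs.
From mathcomp Require Import all_boot.

Set Implicit Arguments.
Unset Strict Implicit.
Unset Printing Implicit Defensive.

(** No automaton is ever built from [phi].  Seen as a word over the alphabet
    [{set 'I_l}], the advice [P] of length [n] satisfies "for every [u] of
    length [n], [phi] holds on [u] with this advice iff the automaton accepts
    [u]".  This property of advice words is expressible in MSO over the
    one-letter alphabet, as [u] and the run of the automaton on [u] can be
    guessed by set quantifiers; so is the property of being the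
    lexicographically least such advice word, and this least word provides
    the regular predicates. *)

(** * Evaluation of formulae and derived connectives *)

Notation form := (mso unit void).
Notation holds n f v V := (sat (nseq_tuple n tt) (@of_void _) f v V).

Lemma push0 T m (t : T) (v : 'I_m -> T) : push t v ord0 = t.
Proof. by rewrite /push unlift_none. Qed.

Lemma pushS T m (t : T) (v : 'I_m -> T) i : push t v (lift ord0 i) = v i.
Proof. by rewrite /push liftK. Qed.

Arguments sat : simpl never.

Section SatEquations.
Variables (A : eqType) (S : Type) (n : nat) (u : n.-tuple A).
Variables (P : S -> {set 'I_n}) (m k : nat).
Variables (v : 'I_m -> 'I_n) (V : 'I_k -> {set 'I_n}).
Notation "f ^s" := (sat u P f v V) (at level 2, format "f ^s").

Lemma sat_Letter a x : (Letter S k a x)^s = (tnth u (v x) == a). Proof. by []. Qed.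
Lemma sat_Pred p x : (Pred A k p x)^s = (v x \in P p). Proof. by []. Qed.
Lemma sat_Le x y : (Le A S k x y)^s = (v x <= v y). Proof. by []. Qed.
Lemma sat_Mem x X : (Defs.Mem A S x X)^s = (v x \in V X). Proof. by []. Qed.
Lemma sat_Not f : (Not f)^s = ~~ f^s. Proof. by []. Qed.
Lemma sat_And f g : (And f g)^s = f^s && g^s. Proof. by []. Qed.
Lemma sat_Or f g : (Or f g)^s = f^s || g^s. Proof. by []. Qed.
Lemma sat_Ex1 f : (Ex1 f)^s = [exists x, sat u P f (push x v) V].
Proof. by []. Qed.
Lemma sat_All1 f : (All1 f)^s = [forall x, sat u P f (push x v) V].
Proof. by []. Qed.
Lemma sat_Ex2 f : (Ex2 f)^s = [exists X, sat u P f v (push X V)].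
Proof. by []. Qed.

Lemma sat_All2 f : (All2 f)^s = [forall X, sat u P f v (push X V)].
Proof. by []. Qed.

(** Since [sat] is blocked for [simpl], these equations unfold it in a controlled way, one
    constructor at a time. *)
Definition satE := (sat_Letter, sat_Pred, sat_Le, sat_Mem, sat_Not, sat_And, sat_Or,
  sat_Ex1, sat_All1, sat_Ex2, sat_All2).

End SatEquations.

(** The syntax has no constants and [m] may be 0, so a position is quantified; being existential,
    the formula is false on the empty word too. *)
Definition falsum m k : form m k := Ex1 (Not (Le _ _ _ ord0 ord0)).

Definition bigOr m k (s : seq (form m k)) : form m k :=
  foldr (@Or _ _ m k) (falsum m k) s.

Definition implies m k (f g : form m k) : form m k := Or (Not f) g.

Definition iff_form m k (f g : form m k) : form m k :=
  Or (And f g) (And (Not f) (Not g)).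

Lemma holds_falsum n m k (v : 'I_m -> 'I_n) (V : 'I_k -> {set 'I_n}) :
  holds n (falsum m k) v V = false.
Proof. by rewrite satE; apply/existsP => -[x]; rewrite !satE leqnn. Qed.

(* Stated for [mem_pred] so that it applies both to [enum T] and [enum D]. *)
Lemma holds_bigOr n m k (I : finType) (D : mem_pred I) (F : I -> form m k)
    (v : 'I_m -> 'I_n) (V : 'I_k -> {set 'I_n}) :
  holds n (bigOr [seq F i | i <- enum_mem D]) v V =
  [exists (i | in_mem i D), holds n (F i) v V].
Proof.
transitivity (has (fun i => holds n (F i) v V) (enum_mem D)).
  by elim: enum_mem => [|i s IHs]; [exact: holds_falsum | rewrite /= satE IHs].
apply/hasP/exists_inP => -[i Di Fi]; exists i => //; first by rewrite mem_enum in Di.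
by rewrite mem_enum.
Qed.

Lemma holds_implies n m k (f g : form m k)
    (v : 'I_m -> 'I_n) (V : 'I_k -> {set 'I_n}) :
  holds n (implies f g) v V = (holds n f v V ==> holds n g v V).
Proof. by rewrite !satE implybE. Qed.

Lemma holds_iff n m k (f g : form m k)
    (v : 'I_m -> 'I_n) (V : 'I_k -> {set 'I_n}) :
  holds n (iff_form f g) v V = (holds n f v V == holds n g v V).
Proof. by rewrite !satE; do 2!case: (sat _ _ _ _ _). Qed.

(** * Quantification over words *)

Definition fibers n (C : eqType) (w : 'I_n -> C) (c : C) : {set 'I_n} :=
  [set x | w x == c].

(* The word [w] is stored in the set variables [b c], one for each letter. *)
Definition codes n k (C : eqType) (V : 'I_k -> {set 'I_n}) (b : C -> 'I_k)
    (w : 'I_n -> C) :=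
  forall c, V (b c) = fibers w c.

Definition catV n c k (W : 'I_c -> {set 'I_n}) (V : 'I_k -> {set 'I_n})
    (i : 'I_(c + k)) : {set 'I_n} :=
  match split i with inl a => W a | inr b => V b end.

(** Environments are functions that are often equal only pointwise; this replaces extensionality. *)
Lemma sat_eq (A : eqType) (S : Type) n (u : n.-tuple A) (P P' : S -> {set 'I_n})
    m k (f : mso A S m k) v v' V V' :
  P =1 P' -> v =1 v' -> V =1 V' -> sat u P f v V = sat u P' f v' V'.
Proof.
move=> EP; have pushE T j (t : T) (w w' : 'I_j -> T) : w =1 w' -> push t w =1 push t w'.
  by move=> Ew i; rewrite /push; case: unlift.
elim: f v v' V V' =>
  [{}m {}k a x|{}m {}k x y|{}m {}k p x|{}m {}k x X|{}m {}k f IHf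
  |{}m {}k f IHf g IHg|{}m {}k f IHf g IHg|{}m {}k f IHf|{}m {}k f IHf
  |{}m {}k f IHf|{}m {}k f IHf] v v' V V' Ev EV; rewrite !satE ?EP ?Ev ?EV //.
- by rewrite (IHf v v' V V').
- by rewrite (IHf v v' V V') ?(IHg v v' V V').
- by rewrite (IHf v v' V V') ?(IHg v v' V V').
- by apply: eq_existsb => x; apply: IHf => //; apply: pushE.
- by apply: eq_forallb => x; apply: IHf => //; apply: pushE.
- by apply: eq_existsb => x; apply: IHf => //; apply: pushE.
- by apply: eq_forallb => x; apply: IHf => //; apply: pushE.
Qed.

(** The successor case typechecks because [c'.+1 + k] computes to [(c' + k).+1]. The quantifier
    added first binds index 0 and is the innermost. *)
Fixpoint ex2n m k c : form m (c + k) -> form m k :=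
  match c return form m (c + k) -> form m k with
  | 0 => id
  | c'.+1 => fun f => @ex2n m k c' (Ex2 f)
  end.

(** Lets an induction on the block size absorb the innermost quantified set into the block. *)
Lemma catV_push n c k X (W : 'I_c -> {set 'I_n}) (V : 'I_k -> {set 'I_n}) :
  push X (catV W V) =1 catV (push X W) V.
Proof.
move=> i; rewrite /catV; case: (unliftP ord0 i) => [j|] ->; last first.
  rewrite push0; case: splitP => [a /= a0|b] //.
  by have -> : a = ord0; [apply: val_inj | rewrite push0].
rewrite pushS; case: splitP => [a /= ja|a /= ja]; case: splitP => [b /= jb|b /= jb].
- by have -> : b = lift ord0 a; [apply: val_inj; rewrite /= -jb ja | rewrite pushS].
(* The splits are at [c] and at [c.+1], with indices shifted by one between them, so the two mixed
   cases contradict the bounds. *)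
- by have := ltn_ord a; rewrite -ja -ltnS -[j.+1]/(bump 0 j) jb ltnNge leq_addr.
- by have := ltn_ord b; rewrite -jb ltnS ja ltnNge leq_addr.
- congr V; apply: val_inj; apply: (@addnI c.+1).
  by rewrite -jb /bump leq0n add1n ja.
Qed.

Lemma holds_ex2n n m k c (f : form m (c + k))
    (v : 'I_m -> 'I_n) (V : 'I_k -> {set 'I_n}) :
  reflect (exists W : 'I_c -> {set 'I_n}, holds n f v (catV W V))
          (holds n (ex2n f) v V).
Proof.
elim: c f => [|c IHc] f.
  have E W : holds n f v (@catV n 0 k W V) = holds n f v V.
    apply: sat_eq => // i; rewrite /catV; case: splitP => [[]|b ib] //.
    by congr V; apply: val_inj.
  by apply: (iffP idP) => [fv|[W]]; [exists (@no_var _); rewrite E | rewrite E].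
apply: (iffP (IHc (Ex2 f))) => [[W]|[W fW]].
  rewrite satE => /existsP[X fX].
  by exists (push X W); rewrite -(sat_eq _ _ (frefl _) (frefl v) (catV_push X W V)).
pose W' (i : 'I_c) := W (lift ord0 i).
exists W'; rewrite satE; apply/existsP; exists (W ord0).
suff E : push (W ord0) (catV W' V) =1 catV W V.
  exact: etrans (sat_eq _ _ (frefl _) (frefl v) E) fW.
move=> i; rewrite catV_push /catV; case: split => // a.
by case: (unliftP ord0 a) => [j|] ->; rewrite ?pushS ?push0.
Qed.

Definition single_letter (C : finType) m k (b : C -> 'I_k) : form m k :=
  All1 (bigOr [seq And (Defs.Mem _ _ ord0 (b c))
      (Not (bigOr [seq Defs.Mem _ _ ord0 (b d) | d <- enum (predC1 c)]))
    | c <- enum C]).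

Lemma single_letterP n (C : finType) m k (b : C -> 'I_k)
    (v : 'I_m -> 'I_n) (V : 'I_k -> {set 'I_n}) :
  reflect (exists w : {ffun 'I_n -> C}, codes V b w)
          (holds n (single_letter m b) v V).
Proof.
rewrite satE; apply: (iffP forallP) => [H|[w wV] x]; last first.
  rewrite holds_bigOr; apply/exists_inP; exists (w x) => //.
  rewrite !satE push0 wV inE eqxx holds_bigOr.
  apply/exists_inP => -[c /negbTE cx].
  by rewrite satE push0 wV inE eq_sym cx.
(* A boolean form of the condition, so that [xchoose] can pick the letter at each position. *)
have {}H x : exists c, [forall d, (x \in V (b d)) == (d == c)].
  move: (H x); rewrite holds_bigOr => /exists_inP[c _].
  rewrite !satE holds_bigOr push0 => /andP[xc /exists_inP xN].
  exists c; apply/forallP => d; have [->|dc] := eqVneq d c; first by rewrite xc.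
  by apply/eqP/idP => xd; case: xN; exists d; rewrite // satE push0.
exists [ffun x => xchoose (H x)] => c; apply/setP => x.
rewrite inE ffunE eq_sym; apply/eqP.
exact: (forallP (xchooseP (H x)) c).
Qed.

(** A newly quantified word occupies the first [#|C|] set variables; [wold] shifts the variables of
    earlier words past them. *)
Definition wnew (C : finType) k (c : C) : 'I_(#|C| + k) :=
  lshift k (enum_rank c).

Definition wold (B : Type) (C : finType) k (b : B -> 'I_k) (x : B) :
  'I_(#|C| + k) := rshift #|C| (b x).
Arguments wold {B} C {k} b x.

Definition addw n (C : finType) k (w : 'I_n -> C) (V : 'I_k -> {set 'I_n}) :=
  catV (fun i : 'I_#|C| => fibers w (enum_val i)) V.

Lemma codes_new n (C : finType) k (w : 'I_n -> C) (V : 'I_k -> {set 'I_n}) :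
  codes (addw w V) (@wnew C k) w.
Proof.
by move=> c; rewrite /addw /catV /wnew (unsplitK (inl _)) enum_rankK.
Qed.

Lemma codes_old n (B : eqType) (C : finType) k (w : 'I_n -> C)
    (V : 'I_k -> {set 'I_n}) (b : B -> 'I_k) (z : 'I_n -> B) :
  codes V b z -> codes (addw w V) (wold C b) z.
Proof. by move=> Vb c; rewrite /addw /catV /wold (unsplitK (inr _)). Qed.

Definition exw (C : finType) m k (f : form m (#|C| + k)) : form m k :=
  ex2n (And (single_letter m (@wnew C k)) f).

Definition allw (C : finType) m k (f : form m (#|C| + k)) : form m k :=
  Not (exw (Not f)).

(** The guard [single_letter] restricts the quantified families of sets to those that code a word,
    and such a family consists of the fibers of that word. *)
Lemma holds_exw n (C : finType) m k (f : form m (#|C| + k))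
    (v : 'I_m -> 'I_n) (V : 'I_k -> {set 'I_n}) :
  holds n (exw f) v V = [exists w : {ffun 'I_n -> C}, holds n f v (addw w V)].
Proof.
apply/holds_ex2n/existsP => [[W]|[w fw]].
  rewrite satE => /andP[/single_letterP[w wW] fW].
  exists w; suff E : addw w V =1 catV W V by rewrite (sat_eq _ _ (frefl _) (frefl v) E).
  move=> i; rewrite /addw /catV; case: (split i) => // a.
  have := wW (enum_val a).
  by rewrite /catV /wnew (unsplitK (inl _)) enum_valK.
exists (fun i : 'I_#|C| => fibers w (enum_val i)); rewrite satE; apply/andP; split=> //.
by apply/single_letterP; exists w; apply: codes_new.
Qed.

Lemma holds_allw n (C : finType) m k (f : form m (#|C| + k))
    (v : 'I_m -> 'I_n) (V : 'I_k -> {set 'I_n}) :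
  holds n (allw f) v V = [forall w : {ffun 'I_n -> C}, holds n f v (addw w V)].
Proof.
rewrite satE holds_exw negb_exists.
by apply: eq_forallb => w; rewrite satE negbK.
Qed.

(** * Acceptance by an automaton *)

Definition first_pos m k (x : 'I_m) : form m k :=
  All1 (Le _ _ _ (lift ord0 x) ord0).

Definition last_pos m k (x : 'I_m) : form m k :=
  All1 (Le _ _ _ ord0 (lift ord0 x)).

Definition succ_pos m k (x y : 'I_m) : form m k :=
  And (Not (Le _ _ _ y x))
      (All1 (Or (Le _ _ _ ord0 (lift ord0 x)) (Le _ _ _ (lift ord0 y) ord0))).

Lemma holds_first_pos n m k (x : 'I_m) (v : 'I_m -> 'I_n)
    (V : 'I_k -> {set 'I_n}) :
  holds n (first_pos k x) v V = (v x == 0 :> nat).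
Proof.
rewrite satE; apply/forallP/eqP => [H|x0 y]; last by rewrite satE pushS x0.
have n0 : 0 < n := leq_ltn_trans (leq0n _) (ltn_ord (v x)).
by have := H (Ordinal n0); rewrite satE pushS push0 leqn0 => /eqP.
Qed.

Lemma holds_last_pos n m k (x : 'I_m) (v : 'I_m -> 'I_n)
    (V : 'I_k -> {set 'I_n}) :
  holds n (last_pos k x) v V = ((v x).+1 == n).
Proof.
rewrite satE; apply/forallP/eqP => [H|xn y]; last by rewrite satE pushS push0 -ltnS xn.
have n1 : n.-1 < n by case: (n) (v x) => [[]|].
have := H (Ordinal n1); rewrite satE pushS push0 => le_n.
by apply/eqP; rewrite eqn_leq ltn_ord -[n in n <= _](ltn_predK n1) ltnS.
Qed.

Lemma holds_succ_pos n m k (x y : 'I_m) (v : 'I_m -> 'I_n)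
    (V : 'I_k -> {set 'I_n}) :
  holds n (succ_pos k x y) v V = (v y == (v x).+1 :> nat).
Proof.
rewrite !satE -ltnNge; apply/andP/eqP => [[lt_xy /forallP H]|xy]; last first.
  split; first by rewrite xy.
  by apply/forallP => z; rewrite !satE !pushS push0 xy; case: leqP.
(* The universal clause is instantiated at the position right after [v x], which exists because
   [v y] lies beyond [v x]. *)
have lt_n : (v x).+1 < n := leq_ltn_trans lt_xy (ltn_ord (v y)).
have := H (Ordinal lt_n); rewrite !satE !pushS push0 /= ltnn /= => le_y.
by apply/eqP; rewrite eqn_leq lt_xy le_y.
Qed.

Section Acceptance.
Variables (A : finType) (M : dfa A).
Notation state := (dfa_state M).
Notation delta := (@dfa_step A M).

(* [r x] is the state reached after reading the letter at position [x]; on the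
   empty word, which has no last position, the last conjunct is needed. *)
Definition is_run n (u : 'I_n -> A) (r : 'I_n -> state) : bool :=
  [&& [forall x : 'I_n,
        (x == 0 :> nat) ==> (r x == delta (dfa_init M) (u x))],
      [forall x : 'I_n, forall y : 'I_n,
        (y == x.+1 :> nat) ==> (r y == delta (r x) (u y))],
      [forall x : 'I_n, (x.+1 == n) ==> (r x \in dfa_final M)]
    & [exists x : 'I_n, true] || (dfa_init M \in dfa_final M)].

(** The automaton is deterministic and complete, so the only candidate run lists the states reached
    after the nonempty prefixes. *)
Lemma dfa_lang_run n (u : n.-tuple A) :
  (tval u \in dfa_lang M) = [exists r : {ffun 'I_n -> state}, is_run (tnth u) r].
Proof.
rewrite -[LHS]/(foldl delta (dfa_init M) u \in dfa_final M).
(* On the empty word the first three conjuncts of [is_run] are vacuous and the fourth decides. *)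
case: n u => [|n] u.
  rewrite (tuple0 u) /=; apply/idP/existsP => [uF|[r /and4P[_ _ _]]].
    exists [ffun=> dfa_init M]; apply/and4P; split; do ?[by apply/forallP=> -[]].
    by rewrite uF orbT.
  by case/orP => // /existsP[[]].
(* [R j] has read the letters at positions 0 to [j], so [R n] has read the whole word, of length
   [n.+1]. *)
pose R j := foldl delta (dfa_init M) (take j.+1 u).
have R0 : R 0 = delta (dfa_init M) (tnth u ord0).
  by rewrite (tnth_nth (tnth u ord0)) /R; case: (tval u) (size_tuple u) => // a s; rewrite /= take0.
have RS (x : 'I_n.+1) j : x = j.+1 :> nat -> R x = delta (R j) (tnth u x).
  move=> xj; rewrite (tnth_nth (tnth u ord0)) /R.
  rewrite (take_nth (tnth u ord0)) ?size_tuple // -cats1 foldl_cat /=.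
  by rewrite xj.
have Rn : foldl delta (dfa_init M) u = R n by rewrite /R take_oversize ?size_tuple.
rewrite Rn; apply/idP/existsP => [uF|[r /and4P[/forallP r0 /forallP rS /forallP rF _]]].
  exists [ffun x : 'I_n.+1 => R x]; apply/and4P; split.
  - apply/forallP => x; apply/implyP => /eqP x0; rewrite ffunE.
    by have -> : x = ord0; [apply: val_inj | rewrite R0].
  - apply/forallP => x; apply/forallP => y; apply/implyP => /eqP xy.
    by rewrite !ffunE (RS _ _ xy).
  - by apply/forallP => x; apply/implyP; rewrite eqSS ffunE => /eqP ->.
  - by apply/orP; left; apply/existsP; exists ord0.
(* Uniqueness of the run, by induction on the position. *)
have rR j (lt_j : j < n.+1) : r (Ordinal lt_j) = R j.
  elim: j lt_j => [|j IHj] lt_j.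
    rewrite R0 (eqP (implyP (r0 _) _)) //.
    by congr (delta _ (tnth u _)); apply: val_inj.
  have /forallP/(_ (Ordinal lt_j)) := rS (Ordinal (ltnW lt_j)).
  by rewrite /= eqxx IHj => /eqP ->; rewrite -RS.
by rewrite -(rR _ (ltnSn n)); apply: (implyP (rF _)).
Qed.

Variables (m k : nat) (b : A -> 'I_k).

Let r : state -> 'I_(#|state| + k) := @wnew state k.
(** The digit counts the position quantifiers in scope; of two, [x2] is the outer and [y2] the inner
    one. *)
Let x1 : 'I_m.+1 := ord0.
Let x2 : 'I_m.+2 := lift ord0 ord0.
Let y2 : 'I_m.+2 := ord0.

(* The last [bigOr] is a constant, true iff the initial state is final. *)
Definition accepts_form : form m k :=
  exw (And (All1 (implies (first_pos _ x1)
             (bigOr [seq And (Defs.Mem _ _ x1 (wold state b a))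
                             (Defs.Mem _ _ x1 (r (delta (dfa_init M) a)))
                    | a <- enum A])))
      (And (All1 (All1 (implies (succ_pos _ x2 y2)
             (bigOr [seq And (Defs.Mem _ _ x2 (r qa.1))
                        (And (Defs.Mem _ _ y2 (wold state b qa.2))
                             (Defs.Mem _ _ y2 (r (delta qa.1 qa.2))))
                    | qa <- enum {: state * A}]))))
      (And (All1 (implies (last_pos _ x1)
             (bigOr [seq Defs.Mem _ _ x1 (r q) | q <- enum (dfa_final M)])))
           (Or (Ex1 (Le _ _ _ x1 x1))
               (bigOr [seq Ex2 (Not (falsum _ _))
                      | q <- enum (predI (pred1 (dfa_init M)) (mem (dfa_final M)))]))))).

Lemma holds_accepts n (u : n.-tuple A) (v : 'I_m -> 'I_n)
    (V : 'I_k -> {set 'I_n}) :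
  codes V b (tnth u) ->
  holds n accepts_form v V = (tval u \in dfa_lang M).
Proof.
move=> Vu; rewrite dfa_lang_run holds_exw; apply: eq_existsb => w.
have Ww : codes (addw w V) r w by apply: codes_new.
have Wu : codes (addw w V) (wold state b) (tnth u) by apply: codes_old.
(* The conjuncts of the formula mirror those of [is_run] and are compared one by one. *)
rewrite !satE; congr [&& _, _, _ & _ || _].
- apply: eq_forallb => x; rewrite holds_implies holds_first_pos push0.
  congr (_ ==> _); rewrite holds_bigOr.
  apply/exists_inP/eqP => [[a _]|wx].
    by rewrite !satE push0 Wu Ww !inE => /andP[/eqP-> /eqP].
  by exists (tnth u x); rewrite // !satE push0 Wu Ww !inE wx ?eqxx.
- apply: eq_forallb => x; rewrite satE; apply: eq_forallb => y.
  rewrite holds_implies holds_succ_pos pushS !push0.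
  congr (_ ==> _); rewrite holds_bigOr.
  apply/exists_inP/eqP => [[[q a] _]|wy].
    by rewrite !satE pushS !push0 Wu !Ww !inE => /and3P[/eqP-> /eqP-> /eqP].
  by exists (w x, tnth u y); rewrite // !satE pushS !push0 Wu !Ww !inE wy ?eqxx.
- apply: eq_forallb => x; rewrite holds_implies holds_last_pos push0.
  congr (_ ==> _); rewrite holds_bigOr.
  apply/exists_inP/idP => [[q qF]|wx]; first by rewrite satE push0 Ww inE => /eqP->.
  by exists (w x); rewrite // satE push0 Ww inE.
- by apply: eq_existsb => x; rewrite satE leqnn.
- rewrite holds_bigOr; apply/exists_inP/idP => [[q /andP[/eqP-> ]]|iF] //.
  exists (dfa_init M); first by apply/andP; split=> /=.
  by rewrite satE; apply/existsP; exists set0; rewrite satE holds_falsum.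
Qed.

End Acceptance.

(** * Advice words *)

Definition lift_map j j' (d : 'I_j -> 'I_j') : 'I_j.+1 -> 'I_j'.+1 :=
  push ord0 (fun i => lift ord0 (d i)).

Lemma push_lift_map T j j' (d : 'I_j -> 'I_j') (t : T) v v' :
  (forall i, v' (d i) = v i) ->
  forall i, push t v' (lift_map d i) = push t v i.
Proof.
move=> E i; rewrite /lift_map.
by case: (unliftP ord0 i) => [h|] ->; rewrite ?pushS ?E ?push0.
Qed.

(* Renames the variables of [f] by [d] and [e], and reads letters and predicate
   symbols in the words stored at [b] and [p]. *)
Fixpoint translate (A S : finType) m k (f : mso A S m k) m' k' :
    ('I_m -> 'I_m') -> ('I_k -> 'I_k') ->
    (A -> 'I_k') -> ({set S} -> 'I_k') -> form m' k' :=
  match f in mso _ _ m k return ('I_m -> 'I_m') -> ('I_k -> 'I_k') ->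
    (A -> 'I_k') -> ({set S} -> 'I_k') -> form m' k' with
  | Letter _ _ a x => fun d e b p => Defs.Mem _ _ (d x) (b a)
  | Le _ _ x y => fun d e b p => Le _ _ _ (d x) (d y)
  | Pred _ _ i x => fun d e b p =>
      bigOr [seq Defs.Mem _ _ (d x) (p c)
            | c <- enum [pred c : {set S} | i \in c]]
  | Defs.Mem _ _ x X => fun d e b p => Defs.Mem _ _ (d x) (e X)
  | Not _ _ f => fun d e b p => Not (translate f d e b p)
  | And _ _ f g => fun d e b p =>
      And (translate f d e b p) (translate g d e b p)
  | Or _ _ f g => fun d e b p =>
      Or (translate f d e b p) (translate g d e b p)
  | Ex1 _ _ f => fun d e b p => Ex1 (translate f (lift_map d) e b p)
  | All1 _ _ f => fun d e b p => All1 (translate f (lift_map d) e b p)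
  | Ex2 _ _ f => fun d e b p =>
      Ex2 (translate f d (lift_map e)
             (fun a => lift ord0 (b a)) (fun c => lift ord0 (p c)))
  | All2 _ _ f => fun d e b p =>
      All2 (translate f d (lift_map e)
              (fun a => lift ord0 (b a)) (fun c => lift ord0 (p c)))
  end.

(** A word over [{set S}] packs all the predicates together; this extracts one track. *)
Definition advice n (S : finType) (z : 'I_n -> {set S}) (i : S) : {set 'I_n} :=
  [set x | i \in z x].

Lemma holds_translate (A S : finType) n (u : n.-tuple A) (z : 'I_n -> {set S})
    m k (f : mso A S m k) m' k' d e b p v V (v' : 'I_m' -> 'I_n)
    (V' : 'I_k' -> {set 'I_n}) :
  (forall x, v' (d x) = v x) -> (forall X, V' (e X) = V X) ->
  codes V' b (tnth u) -> codes V' p z ->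
  holds n (translate f d e b p) v' V' = sat u (advice z) f v V.
Proof.
(* Coded words survive a set quantifier once their variables are lifted, as [translate] does. *)
have pushC (C : eqType) j (W : 'I_j -> {set 'I_n}) X c (w : 'I_n -> C) :
    codes W c w -> codes (push X W) (fun a => lift ord0 (c a)) w.
  by move=> E a; rewrite pushS.
elim: f m' k' d e b p v V v' V' =>
  [{}m {}k a x|{}m {}k x y|{}m {}k i x|{}m {}k x X|{}m {}k f IHf
  |{}m {}k f IHf g IHg|{}m {}k f IHf g IHg|{}m {}k f IHf|{}m {}k f IHf
  |{}m {}k f IHf|{}m {}k f IHf] m' k' d e b p v V v' V' Ev Ve Vb Vp.
- by rewrite !satE Vb inE Ev.
- by rewrite !satE !Ev.
(* The only letter [c] that can witness the disjunction is the advice letter at the position. *)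
- rewrite holds_bigOr satE inE; apply/exists_inP/idP => [[c ic]|ix].
    by rewrite satE Vp inE Ev => /eqP->.
  by exists (z (v x)); rewrite // satE Vp inE Ev.
- by rewrite !satE Ve Ev.
- by rewrite !satE (IHf _ _ _ _ _ _ v V).
- by rewrite !satE (IHf _ _ _ _ _ _ v V) ?(IHg _ _ _ _ _ _ v V).
- by rewrite !satE (IHf _ _ _ _ _ _ v V) ?(IHg _ _ _ _ _ _ v V).
- by rewrite !satE; apply: eq_existsb => x; apply: IHf => //; apply: push_lift_map.
- by rewrite !satE; apply: eq_forallb => x; apply: IHf => //; apply: push_lift_map.
- by rewrite !satE; apply: eq_existsb => X; apply: IHf;
    [| apply: push_lift_map | apply: pushC | apply: pushC].
- by rewrite !satE; apply: eq_forallb => X; apply: IHf;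
    [| apply: push_lift_map | apply: pushC | apply: pushC].
Qed.

(** * Lexicographic order on words of equal length *)

Section Lex.
Variable B : finType.

(** Letters are ordered by their rank in the finite alphabet, so comparing two letters is a finite
    disjunction over pairs, hence expressible. *)
Definition lex_lt n (w w' : 'I_n -> B) : bool :=
  [exists x : 'I_n, [forall y : 'I_n, (y < x) ==> (w y == w' y)] &&
    (enum_rank (w x) < enum_rank (w' x))].

Lemma lex_lt_irr n (w : 'I_n -> B) : lex_lt w w = false.
Proof. by apply/existsP => -[x /andP[_]]; rewrite ltnn. Qed.

(** The smaller of the two positions of first difference is the position of first difference of [w1]
    and [w3]. *)
Lemma lex_lt_trans n (w1 w2 w3 : 'I_n -> B) :
  lex_lt w1 w2 -> lex_lt w2 w3 -> lex_lt w1 w3.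
Proof.
case/existsP=> x /andP[/forallP w12 lt12] /existsP[y /andP[/forallP w23 lt23]].
apply/existsP; have [lt_xy|lt_yx|eq_xy] := ltngtP x y.
- exists x; rewrite -(eqP (implyP (w23 x) lt_xy)) lt12 andbT.
  apply/forallP => t; apply/implyP => lt_tx.
  by rewrite (eqP (implyP (w12 t) lt_tx)) (implyP (w23 t)) // (ltn_trans lt_tx).
- exists y; rewrite (eqP (implyP (w12 y) lt_yx)) lt23 andbT.
  apply/forallP => t; apply/implyP => lt_ty.
  by rewrite (eqP (implyP (w12 t) (ltn_trans lt_ty lt_yx))) (implyP (w23 t)).
- have {}eq_xy : x = y by apply: val_inj.
  exists x; rewrite (ltn_trans lt12) ?eq_xy // andbT.
  apply/forallP => t; apply/implyP => lt_t.
  by rewrite (eqP (implyP (w12 t) _)) ?(implyP (w23 t)) // eq_xy.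
Qed.

Lemma lex_lt_total n (w w' : {ffun 'I_n -> B}) :
  w != w' -> lex_lt w w' || lex_lt w' w.
Proof.
move=> neq_ww'.
have [x0 wx0] : exists x, w x != w' x.
  apply/existsP; apply: contraR neq_ww'; rewrite negb_exists => /forallP E.
  by apply/eqP/ffunP => x; apply/eqP; rewrite -[_ == _]negbK.
(* [x] is the first position where the words differ; the letters there decide. *)
case: (arg_minnP (P := fun x => w x != w' x) val wx0) => x wx min_x.
have E (y : 'I_n) : y < x -> w y == w' y.
  by rewrite ltnNge; apply: contraNT => /min_x.
have [lt|gt|/val_inj/enum_rank_inj/eqP] := ltngtP (enum_rank (w x)) (enum_rank (w' x)).
- apply/orP; left; apply/existsP; exists x; rewrite lt andbT.
  by apply/forallP => y; apply/implyP/E.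
- apply/orP; right; apply/existsP; exists x; rewrite gt andbT.
  by apply/forallP => y; apply/implyP; rewrite eq_sym; apply: E.
- by rewrite (negbTE wx).
Qed.

(** The boolean equation has the shape of the formula that will define the least word, and it
    includes uniqueness. *)
Lemma lex_least n (D : pred {ffun 'I_n -> B}) w0 : D w0 ->
  exists2 w, D w & forall w', D w' && ~~ [exists t, D t && lex_lt t w'] = (w' == w).
Proof.
move=> Dw0.
(* An element of [D] with fewest predecessors is least: a smaller word would have strictly fewer, by
   transitivity and irreflexivity. *)
case: (arg_minnP (fun w : {ffun 'I_n -> B} =>
  #|[pred t : {ffun 'I_n -> B} | lex_lt t w]|) Dw0).
move=> w Dw min_w.
have least w' : D w' -> lex_lt w' w = false.
  move=> Dw'; apply: negbTE; apply: contraL (min_w _ Dw') => lt_w'w.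
  rewrite -ltnNge; apply: proper_card; apply/properP; split.
    by apply/subsetP => t; rewrite !inE => lt_t; apply: lex_lt_trans lt_t lt_w'w.
  by exists w'; rewrite ?inE // lex_lt_irr.
exists w => // w'; apply/andP/eqP => [[Dw' /existsPn lt_w']|->].
  apply/eqP; apply: contraT => /lex_lt_total; rewrite least //= => lt_ww'.
  by have := lt_w' w; rewrite Dw lt_ww'.
by split=> //; apply/existsPn => t; apply/negP => /andP[/least->].
Qed.

Definition lex_form m k (b c : B -> 'I_k) : form m k :=
  Ex1 (And (All1 (Or (Le _ _ _ (lift ord0 ord0) ord0)
               (bigOr [seq And (Defs.Mem _ _ ord0 (b a)) (Defs.Mem _ _ ord0 (c a))
                      | a <- enum B])))
           (bigOr [seq And (Defs.Mem _ _ ord0 (b a.1)) (Defs.Mem _ _ ord0 (c a.2))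
                  | a <- enum [pred a : B * B | enum_rank a.1 < enum_rank a.2]])).

Lemma holds_lex n m k (b c : B -> 'I_k) (w w' : 'I_n -> B) (v : 'I_m -> 'I_n)
    (V : 'I_k -> {set 'I_n}) :
  codes V b w -> codes V c w' -> holds n (lex_form m b c) v V = lex_lt w w'.
Proof.
move=> Vb Vc; rewrite satE; apply: eq_existsb => x; rewrite satE; congr (_ && _).
  rewrite satE; apply: eq_forallb => y; rewrite implybE -leqNgt.
  rewrite !satE pushS !push0; congr (_ || _).
  rewrite holds_bigOr; apply/exists_inP/eqP => [[a _]|wy].
    by rewrite !satE !push0 Vb Vc !inE => /andP[/eqP-> /eqP].
  by exists (w y); rewrite // !satE !push0 Vb Vc !inE wy ?eqxx.
rewrite holds_bigOr; apply/exists_inP/idP => [[a lt_a]|lt_w].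
  by rewrite !satE !push0 Vb Vc !inE => /andP[/eqP-> /eqP->].
by exists (w x, w' x); rewrite // !satE !push0 Vb Vc !inE ?eqxx.
Qed.

End Lex.

(** * Good advice words and the definability of the least one *)

Section Advice.
Variables (A S : finType) (phi : mso A S 0 0) (M : dfa A).
Notation B := {set S}.

Definition good_advice n (z : {ffun 'I_n -> B}) : bool :=
  [forall w : {ffun 'I_n -> A},
     sat (mktuple w) (advice z) phi (@no_var _) (@no_var _)
       == (tval (mktuple w) \in dfa_lang M)].

Lemma good_advice_language n (z : {ffun 'I_n -> B}) (u : n.-tuple A) :
  good_advice z ->
  sat u (advice z) phi (@no_var _) (@no_var _) = (tval u \in dfa_lang M).
Proof.
move/forallP/(_ [ffun x => tnth u x])/eqP.
suff -> : mktuple [ffun x => tnth u x] = u by [].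
by apply: eq_from_tnth => x; rewrite tnth_mktuple ffunE.
Qed.

Definition good_form m k (p : B -> 'I_k) : form m k :=
  allw (iff_form (translate phi (@no_var _) (@no_var _) (@wnew A k) (wold A p))
                 (accepts_form M m (@wnew A k))).

Lemma holds_good n m k (p : B -> 'I_k) (z : {ffun 'I_n -> B})
    (v : 'I_m -> 'I_n) (V : 'I_k -> {set 'I_n}) :
  codes V p z -> holds n (good_form m p) v V = good_advice z.
Proof.
move=> Vz; rewrite holds_allw; apply: eq_forallb => w.
have Ww : codes (addw w V) (@wnew A k) (tnth (mktuple w)).
  move=> a; rewrite codes_new; apply/setP => x.
  by rewrite !inE tnth_mktuple.
rewrite holds_iff (holds_accepts _ _ Ww); congr (_ == _).
by apply: holds_translate => //; [case | case | apply: codes_old].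
Qed.

(** The free variable is the tested position: some good word has [i] in its letter there, and no
    good word is smaller. *)
Definition least_advice_form (i : S) : form 1 0 :=
  exw (And (bigOr [seq Defs.Mem _ _ ord0 (@wnew B 0 s) | s <- enum [pred s : B | i \in s]])
      (And (good_form 1 (@wnew B 0))
           (Not (exw (And (good_form 1 (@wnew B _))
                          (lex_form 1 (@wnew B _) (wold B (@wnew B 0)))))))).

(** Each formula guesses its own word at each position; uniqueness of the least good word forces all
    guesses to be the same [z]. *)
Lemma holds_least_advice n (z0 : {ffun 'I_n -> B}) : good_advice z0 ->
  exists2 z : {ffun 'I_n -> B}, good_advice z &
    forall i, advice z i =
      [set x | holds n (least_advice_form i) (fun=> x) (@no_var _)].
Proof.
case/lex_least => z good_z least_z; exists z => // i.
apply/setP => x; rewrite !inE holds_exw.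
transitivity [exists w : {ffun 'I_n -> B}, (i \in w x) && (w == z)].
  apply/idP/existsP => [iz|[w /andP[iw /eqP<-]]] //.
  by exists z; rewrite iz eqxx.
apply: eq_existsb => w; rewrite 2!sat_And.
have Ww : codes (addw w (@no_var {set 'I_n})) (@wnew B 0) w by apply: codes_new.
rewrite (holds_good _ Ww) holds_bigOr sat_Not -least_z; congr [&& _, _ & ~~ _].
  apply/idP/exists_inP => [iw|[s si]].
    by exists (w x); rewrite // satE Ww inE.
  by rewrite satE Ww inE => /eqP->.
rewrite holds_exw; apply: eq_existsb => t; rewrite sat_And.
have Tt := codes_new t (addw w (@no_var {set 'I_n})).
by rewrite (holds_good _ Tt) (holds_lex _ Tt (codes_old t Ww)).
Qed.

End Advice.

(** * Replacing the predicates by regular ones *)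

Lemma language_tuple (A : eqType) S (phi : mso A S 0 0)
    (P : S -> monadic_predicate) n (u : n.-tuple A) :
  language phi P u = sat u (fun p => P p n) phi (@no_var _) (@no_var _).
Proof.
case: u => u eq_u; have /eqP En := eq_u; subst n.
by rewrite /language; have -> : in_tuple u = Tuple eq_u by apply: val_inj.
Qed.

Theorem mainTheorem3 (A : finType) (l : nat) (phi : mso A 'I_l 0 0)
    (P : 'I_l -> monadic_predicate)
    (regL : regular_language (language phi P)) :
  exists Q : 'I_l -> monadic_predicate,
    (forall i : 'I_l, regular_predicate (Q i)) /\
    language phi Q =i language phi P.
Proof.
have [M LM] := regL.
(* One formula per symbol serves all lengths, so regularity holds by definition. *)
exists (fun i n => [set x : 'I_n |
  holds n (least_advice_form phi M i) (fun=> x) (@no_var _)]); split.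
  by move=> i; exists (least_advice_form phi M i).
move=> u; rewrite LM.
(* The given predicates, packed into a word, show that good advice of length [n] exists. *)
pose n := size u; pose z0 := [ffun x : 'I_n => [set i | x \in P i n]].
have Pz0 i : advice z0 i = P i n by apply/setP => x; rewrite inE ffunE inE.
have good_z0 : good_advice phi M z0.
  apply/forallP => w; rewrite (sat_eq _ _ Pz0 (frefl _) (frefl _)) -language_tuple.
  by apply/eqP; apply: LM.
have [z good_z advice_z] := holds_least_advice good_z0.
(* The least advice [z] may differ from [z0], but being good it yields the verdict of the automaton
   on [u]. *)
rewrite -[RHS](good_advice_language (in_tuple u) good_z).
by apply: sat_eq => // i; rewrite advice_z.
Qed.
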